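(* There exists an absolute constant $\alpha < 1$ such that for every connected digraph $D$ without digons with $\tilde{\Delta}(D) > 1$, we have $\chi(D) \leq \alpha(\tilde{\Delta}(D) + 1)$.
   Context: All digraphs are finite and simple (no loops, no two arcs with the same initial and the same terminal vertex). A digon is a pair of arcs $xy$, $yx$. $D$ is connected if its underlying undirected graph is connected. $\tilde{\Delta}(D) = \max\{\sqrt{d^{+}(v)d^{-}(v)} : v \in V(D)\}$, where $d^{+}, d^{-}$ are out- and in-degree. A set $A \subseteq V(D)$ is acyclic if $D[A]$ has no directed cycle; $\chi(D)$ is the least $k$ such that $V(D)$ can be partitioned into $k$ acyclic sets. *)

(* Defs.v *)
From mathcomp Require Import all_boot all_order all_algebra.
From mathcomp Require Import boolp reals.
Set Implicit Arguments.
Unset Strict Implicit.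
Unset Printing Implicit Defensive.
Import Order.TTheory GRing.Theory Num.Theory.
Local Open Scope ring_scope.

Record digraph := Digraph {
  vertex :> finType;
  arc : rel vertex;
  arc_irreflexive : irreflexive arc
}.

Section Digraph.
Variable D : digraph.
Implicit Types (x y v : D) (A : {set D}) (P : {set {set D}}) (c : seq D).

Definition outdeg v : nat := #|[set w | arc v w]|.
Definition indeg v : nat := #|[set u | arc u v]|.

Definition digon x y : bool := arc x y && arc y x.
Definition digon_free : Prop := forall x y, ~~ digon x y.

Definition adjacent : rel D := [rel x y | arc x y || arc y x].
Definition connected_digraph : Prop := forall x y, connect adjacent x y.

(* A digon counts as a directed cycle of length 2. *)
Definition directed_cycle c : Prop := c <> [::] /\ ucycle (@arc D) c.

Definition acyclic A : Prop :=
  ~ exists c, directed_cycle c /\ {subset c <= A}.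

Definition acyclic_partition P : Prop :=
  partition P [set: D] /\ forall A, A \in P -> acyclic A.

Definition partitionable (k : nat) : Prop :=
  exists P, acyclic_partition P /\ #|P| = k.

Lemma acyclic1 v : acyclic [set v].
Proof.
case=> -[|x c] [[//= _ /andP[xc /andP[xNc _]]] sub].
have /set1P xv := sub x (mem_head _ _); subst x.
case: c xc xNc sub => [|y c]; first by rewrite /= arc_irreflexive.
move=> _ vNc sub.
have /set1P yv : y \in [set v] by apply: sub; rewrite !inE eqxx orbT.
by rewrite yv mem_head in vNc.
Qed.

Lemma partitionable_ex : exists k, `[< partitionable k >].
Proof.
exists #|preim_partition (@id D) [set: D]|; apply/asboolP.
exists (preim_partition id [set: D]); split=> //; split.
  exact: preim_partitionP.
move=> A /imsetP[v _ ->].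
suff -> : [set y in [set: D] | v == y] = [set v] by exact: acyclic1.
by apply/setP=> y; rewrite !inE eq_sym.
Qed.

Definition dichromatic_number : nat := ex_minn partitionable_ex.

(* All terms are >= 0, so the default value 0 only matters when D has no
   vertex. *)
Definition max_geom_degree (R : realType) : R :=
  \big[Num.max/0]_(v : D) Num.sqrt ((outdeg v)%:R * (indeg v)%:R).

End Digraph.

(* Main.v *)
(* Let [N] be the maximum of [d+(v) d-(v)]. If [D] is not [k]-colourable, a
   minimal non-[k]-colourable set [B] of vertices induces in- and out-degrees
   [x, y >= k]; as [x y <= N], also [k (x + y) <= N + k^2]. Lovasz's partition
   argument then splits [B] into [k/2] parts of total degree at most 4 (if [k]
   is odd, one further part of total degree at most 1), provided
   [2 N < 3 k^2 - k]. A part of total degree at most 1 is acyclic, and a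
   digon-free part of total degree at most 4 is 2-colourable: otherwise,
   starting from a 2-colouring with a single uncoloured vertex (the hole), one
   can keep moving the hole to in-neighbours of alternating colours without
   ever coming back, which is absurd. So [D] is [k]-colourable for the least
   [k >= 2] with [2 N < 3 k^2 - k], and this [k] is at most
   [19/20 (sqrt N + 1)]. *)
Require Import Defs.
From mathcomp Require Import all_boot all_order all_algebra.
From mathcomp Require Import boolp reals.
From mathcomp Require Import zify lra.
(* [path.arc] would otherwise shadow the arc relation of digraphs. *)
Import Defs.
Import Order.TTheory GRing.Theory Num.Theory.
Local Open Scope ring_scope.
Set Implicit Arguments.
Unset Strict Implicit.

Section Coloring.
Local Open Scope nat_scope.
Variable D : digraph.
Implicit Types (u v w x g h o : D) (A B X : {set D}).

(** * Directed cycles created by adding one vertex *)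

Lemma acyclicS A B : A \subset B -> acyclic B -> acyclic A.
Proof.
by move=> /subsetP sAB acB [c [cc sub]]; apply: acB; exists c; split=> // x /sub/sAB.
Qed.

(** Every new cycle passes through [h]; rotated to start there, the rest of it is the path [o :: p]
    inside [B]. *)
Lemma acyclic_addN h B : acyclic B -> ~ acyclic (h |: B) ->
  exists g o, exists p : seq D, [/\ g \in B, o \in B, arc g h, arc h o &
    [/\ path (@arc D) o p, last o p = g & {subset o :: p <= B}]].
Proof.
move=> acB /contrapT [c [[c0 /andP[cyc unc]] sub]].
have hc : h \in c.
  apply: contrapT => /negP hNc; apply: acB; exists c; split; first by split=> //; apply/andP.
  move=> x xc; have /setU1P[xh|//] := sub x xc.
  by rewrite -xh xc in hNc.
have [i p cE] := rot_to hc.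
move: cyc unc; rewrite -(rot_cycle i) -(rot_uniq i) cE.
have {}sub x : x \in h :: p -> x \in h |: B by rewrite -cE mem_rot; apply: sub.
case: p cE sub => [|o p] cE sub; first by rewrite /= arc_irreflexive.
rewrite /= rcons_path => /and3P[ho pp gh] /andP[hNp _].
have subB : {subset o :: p <= B}.
  move=> x xp; have /setU1P[xh|//] := sub x (mem_behead (s := h :: o :: p) xp).
  by rewrite -xh xp in hNp.
exists (last o p), o, p; split=> //; apply: subB; [exact: mem_last|exact: mem_head].
Qed.

Lemma acyclic_add_source h B :
  acyclic B -> (forall u, u \in B -> ~~ arc u h) -> acyclic (h |: B).
Proof.
move=> acB noin; apply: contrapT => /(acyclic_addN acB)[g [o [p [gB _ gh _ _]]]].
by move: (noin g gB); rewrite gh.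
Qed.

Lemma acyclic_add_sink h B :
  acyclic B -> (forall u, u \in B -> ~~ arc h u) -> acyclic (h |: B).
Proof.
move=> acB noout; apply: contrapT => /(acyclic_addN acB)[g [o [p [_ oB _ ho _]]]].
by move: (noout o oB); rewrite ho.
Qed.

Lemma acyclic0 : acyclic (set0 : {set D}).
Proof.
move=> [[|x c] [[c0 _] sub]] //.
by have := sub x (mem_head _ _); rewrite inE.
Qed.

(** * Degrees inside a set, colourings and Lovasz's partition *)

Definition in_degree A v := #|[set u in A | arc u v]|.
Definition out_degree A v := #|[set w in A | arc v w]|.
Definition degree A v := in_degree A v + out_degree A v.

Lemma in_degree_sum A v : in_degree A v = \sum_(u in A) arc u v.
Proof.
rewrite /in_degree -sum1_card big_mkcond [RHS]big_mkcond /=.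
by apply: eq_bigr => u _; rewrite !inE; case: (u \in A); case: arc.
Qed.

Lemma out_degree_sum A v : out_degree A v = \sum_(w in A) arc v w.
Proof.
rewrite /out_degree -sum1_card big_mkcond [RHS]big_mkcond /=.
by apply: eq_bigr => u _; rewrite !inE; case: (u \in A); case: arc.
Qed.

Lemma in_degree_le A v : in_degree A v <= indeg v.
Proof. by apply: subset_leq_card; apply/subsetP => u; rewrite !inE => /andP[]. Qed.

Lemma out_degree_le A v : out_degree A v <= outdeg v.
Proof. by apply: subset_leq_card; apply/subsetP => u; rewrite !inE => /andP[]. Qed.

Definition color_class {T : eqType} A (f : D -> T) i := [set v in A | f v == i].

Definition colorable A k := exists f : D -> nat,
  (forall v, v \in A -> f v < k) /\ forall i, acyclic (color_class A f i).

Lemma colorableU k l X A : X \subset A ->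
  colorable X k -> colorable (A :\: X) l -> colorable A (k + l).
Proof.
move=> sXA [f [fk fac]] [e [el eac]].
exists (fun v => if v \in X then f v else k + e v); split.
  move=> v vA; case: ifPn => vX; first by rewrite ltn_addr // fk.
  by rewrite ltn_add2l el // inE vX.
move=> i; have [ik|ki] := ltnP i k.
  apply: acyclicS (fac i); apply/subsetP => v; rewrite !inE => /andP[vA].
  by case: ifPn => //= _ /eqP vi; lia.
apply: acyclicS (eac (i - k)); apply/subsetP => v; rewrite !inE => /andP[vA].
case: ifPn => /= [vX /eqP vi|vX /eqP vi]; first by have := fk v vX; lia.
by rewrite vA; apply/eqP; lia.
Qed.

Definition inner_arcs X := \sum_(u in X) \sum_(w in X) arc u w.

Lemma inner_arcsU1 v X : v \notin X -> inner_arcs (v |: X) = inner_arcs X + degree X v.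
Proof.
move=> vX; rewrite /inner_arcs big_setU1 //= big_setU1 //= arc_irreflexive add0n.
under [in X in _ + X]eq_bigr => u _ do rewrite big_setU1 //=.
by rewrite big_split /= -in_degree_sum -out_degree_sum /degree; lia.
Qed.

Lemma in_degreeD X A v : X \subset A ->
  in_degree X v + in_degree (A :\: X) v = in_degree A v.
Proof.
by move=> sXA; rewrite !in_degree_sum [RHS](big_setID X) /= (setIidPr sXA).
Qed.

Lemma out_degreeD X A v : X \subset A ->
  out_degree X v + out_degree (A :\: X) v = out_degree A v.
Proof.
by move=> sXA; rewrite !out_degree_sum [RHS](big_setID X) /= (setIidPr sXA).
Qed.

Lemma degreeD X A v : X \subset A -> degree X v + degree (A :\: X) v = degree A v.
Proof.
by move=> sXA; rewrite /degree -(in_degreeD _ sXA) -(out_degreeD _ sXA); lia.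
Qed.

Lemma degreeD1 A v : degree (A :\ v) v = degree A v.
Proof.
rewrite /degree /in_degree /out_degree; congr addn;
  by apply: eq_card => u; rewrite !inE; case: eqP => //= ->; rewrite arc_irreflexive andbF.
Qed.

(* Lovasz: minimise the number of inner arcs of the two parts, weighted by
   [b.+1] and [a.+1] respectively. *)
Lemma degree_split A a b : (forall v, v \in A -> degree A v <= a + b + 1) ->
  exists X, [/\ X \subset A, forall v, v \in X -> degree X v <= a &
                forall v, v \in A :\: X -> degree (A :\: X) v <= b].
Proof.
move=> degA.
pose pot X := b.+1 * inner_arcs X + a.+1 * inner_arcs (A :\: X).
have [X sXA minX] := @arg_minnP _ set0 (fun X => X \subset A) pot (sub0set A).
exists X; split=> // v.
- move=> vX; rewrite leqNgt; apply/negP => dv.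
  have vA : v \in A by apply: (subsetP sXA).
  have sX' : X :\ v \subset A by apply: subset_trans sXA; apply: subsetDl.
  have := minX _ sX'; rewrite /pot.
  have -> : A :\: (X :\ v) = v |: (A :\: X).
    by apply/setP => u; rewrite !inE; case: eqP => //= ->.
  rewrite inner_arcsU1 ?inE ?vX //.
  have := inner_arcsU1 (v := v) (X := X :\ v); rewrite setD1K // setD11 degreeD1 => /(_ isT) ->.
  (* Minimality gives [b.+1 * degree X v <= a.+1 * degree (A :\: X) v]; but [degree X v > a] forces
     [degree (A :\: X) v <= b], a contradiction. The other part is symmetric. *)
  by have := degreeD v sXA; have := degA v vA; nia.
- move=> vAX; rewrite leqNgt; apply/negP => dv.
  have [vX vA] : v \notin X /\ v \in A by apply/andP; move: vAX; rewrite inE.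
  have sX' : v |: X \subset A by rewrite subUset sub1set vA.
  have := minX _ sX'; rewrite /pot inner_arcsU1 //.
  have -> : A :\: (v |: X) = (A :\: X) :\ v.
    by apply/setP => u; rewrite !inE negb_or andbA.
  have := inner_arcsU1 (v := v) (X := (A :\: X) :\ v).
  rewrite setD1K // setD11 degreeD1 => /(_ isT) ->.
  by have := degreeD v sXA; have := degA v vA; nia.
Qed.

Definition degree_colorable d k :=
  forall A, (forall v, v \in A -> degree A v <= d) -> colorable A k.

Lemma degree_colorableD a b k l : degree_colorable a k -> degree_colorable b l ->
  degree_colorable (a + b + 1) (k + l).
Proof.
move=> ca cb A /degree_split[X [sXA dX dAX]].
by apply: (colorableU sXA); [exact: ca|exact: cb].
Qed.

(** On a directed cycle every vertex has both an in- and an out-neighbour, hence degree at least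
    2. *)
Lemma degree_colorable1 : degree_colorable 1 1.
Proof.
move=> A degA; exists (fun=> 0); split=> // i.
apply: (@acyclicS _ A); first by apply/subsetP => v; rewrite inE => /andP[].
move=> [[|x [|o p]] [[c0 /andP[/= cyc _]] sub]] //.
  by rewrite arc_irreflexive in cyc.
move: cyc; rewrite rcons_path => /and3P[xo _ lx].
have := degA x (sub x (mem_head _ _)); rewrite leqNgt => /negP; apply.
apply: (@leq_add 1 1); apply/card_gt0P; [exists (last o p)|exists o];
  by rewrite inE sub // !inE ?eqxx ?mem_last ?orbT //= -in_cons mem_last orbT.
Qed.

(** * Two-colouring digon-free sets of degree at most 4 by moving a hole *)

Section FourDegrees.
Hypothesis no_digon : digon_free D.
Variable A : {set D}.
Hypothesis degA : forall v, v \in A -> degree A v <= 4.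
Hypothesis not_bicolorable :
  ~ exists f : D -> bool, forall b, acyclic (color_class A f b).
Implicit Types (f : D -> bool) (s : seq D).

(* The value of [f] at the hole [h] itself is irrelevant; it is used to record
   the colour [h] receives when the hole moves on. *)
Definition colored_off f h :=
  h \in A /\ forall b, acyclic (color_class (A :\ h) f b).

Lemma colored_off_eq f f' h :
  (forall v, v != h -> f v = f' v) -> colored_off f h -> colored_off f' h.
Proof.
move=> eqf [hA acf]; split=> // b; apply: acyclicS (acf b).
apply/subsetP => v; rewrite !inE -andbA => /and3P[vh vA fv].
by rewrite vh vA eqf.
Qed.

(** Giving the hole colour [b] must close a cycle, on which [g] and [o] are its neighbours. Without
    digons [g] differs from [o], so the predecessor [x] of [g] on the cycle is not the hole. *)
Lemma hole_neighbors f h b : colored_off f h ->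
  exists g o x, [/\ g \in color_class (A :\ h) f b,
    o \in color_class (A :\ h) f b, x \in color_class (A :\ h) f b &
    [/\ arc g h, arc h o & arc x g]].
Proof.
move=> [hA acf].
have /(acyclic_addN (acf b)) : ~ acyclic (h |: color_class (A :\ h) f b).
  move=> ach; apply: not_bicolorable; exists [eta f with h |-> b] => b'.
  have [->|bb'] := eqVneq b' b.
    apply: acyclicS ach; apply/subsetP => v; rewrite !inE /=.
    by case: (v == h).
  apply: acyclicS (acf b'); apply/subsetP => v; rewrite !inE /=.
  by have [_|//] := eqVneq v h; rewrite [_ == b']eq_sym (negPf bb') andbF.
move=> [g [o [p [gB oB gh ho]]]].
case/lastP: p => [|p y]; first case=> _ /= og _.
  by have := no_digon h g; rewrite /digon -{1}og ho gh.
rewrite rcons_path last_rcons => -[/andP[_ xg] yg sub]; rewrite {}yg in xg sub.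
exists g, o, (last o p); split=> //.
by apply: sub; rewrite -rcons_cons mem_rcons in_cons mem_last orbT.
Qed.

(** The hole has an in- and an out-neighbour of each colour; a second in-neighbour of one colour
    would raise its degree to 3 + 2 > 4. *)
Lemma hole_in_neighbor_uniq f h u u' : colored_off f h ->
  u \in A -> u' \in A -> f u = f u' -> arc u h -> arc u' h -> u = u'.
Proof.
move=> cfh uA u'A fuu' uh u'h; apply/eqP; apply/negP => /negP uu'.
have [g [o [_ [gb ob _ [gh ho _]]]]] := hole_neighbors (~~ f u) cfh.
have [_ [o' [_ [_ ob' _ [_ ho' _]]]]] := hole_neighbors (f u) cfh.
move: gb ob ob'; rewrite !inE -!andbA => /and3P[_ gA /eqP fg] /and3P[_ oA /eqP fo].
move=> /and3P[_ oA' /eqP fo'].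
have := degA (proj1 cfh); rewrite leqNgt => /negP; apply.
apply: (@leq_add 3 2).
  have <- : #|[set g; u; u']| = 3.
    rewrite -setUA cardsU1 cards2 uu' !inE negb_or.
    have [gu|_] := eqVneq g u; first by rewrite gu in fg; case: (f u) fg.
    have [gu|//] := eqVneq g u'.
    by rewrite gu fuu' in fg; case: (f u') fg.
  apply: subset_leq_card; apply/subsetP => v; rewrite !inE -orbA.
  by move=> /or3P[] /eqP ->; apply/andP.
have <- : #|[set o; o']| = 2.
  rewrite cards2; have [oo|//] := eqVneq o o'.
  by move: fo; rewrite oo fo'; case: (f u).
apply: subset_leq_card; apply/subsetP => v; rewrite !inE.
by move=> /orP[] /eqP ->; apply/andP.
Qed.

Lemma hole_out_neighbor_uniq f h u u' : colored_off f h ->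
  u \in A -> u' \in A -> f u = f u' -> arc h u -> arc h u' -> u = u'.
Proof.
move=> cfh uA u'A fuu' uh u'h; apply/eqP; apply/negP => /negP uu'.
have [o [g [_ [ob gb _ [ho gh _]]]]] := hole_neighbors (~~ f u) cfh.
have [o' [_ [_ [ob' _ _ [ho' _ _]]]]] := hole_neighbors (f u) cfh.
move: gb ob ob'; rewrite !inE -!andbA => /and3P[_ gA /eqP fg] /and3P[_ oA /eqP fo].
move=> /and3P[_ oA' /eqP fo'].
have := degA (proj1 cfh); rewrite leqNgt => /negP; apply.
apply: (@leq_add 2 3); last first.
  have <- : #|[set g; u; u']| = 3.
    rewrite -setUA cardsU1 cards2 uu' !inE negb_or.
    have [gu|_] := eqVneq g u; first by rewrite gu in fg; case: (f u) fg.
    have [gu|//] := eqVneq g u'.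
    by rewrite gu fuu' in fg; case: (f u') fg.
  apply: subset_leq_card; apply/subsetP => v; rewrite !inE -orbA.
  by move=> /or3P[] /eqP ->; apply/andP.
have <- : #|[set o; o']| = 2.
  rewrite cards2; have [oo|//] := eqVneq o o'.
  by move: fo; rewrite oo fo'; case: (f u).
apply: subset_leq_card; apply/subsetP => v; rewrite !inE.
by move=> /orP[] /eqP ->; apply/andP.
Qed.

(** The old hole takes colour [f h]. As [g] is its only in-neighbour (or out-neighbour) of that
    colour, removing [g] makes it a source (or sink) of its class, so it lies on no cycle there. *)
Lemma colored_off_move f h g : colored_off f h -> g \in A -> f g = f h ->
  adjacent g h -> colored_off f g.
Proof.
move=> cfh gA fgh /= adj; split=> // b; case: (cfh) => hA acf.
have [bE|bN] := eqVneq b (f h); last first.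
  apply: acyclicS (acf b); apply/subsetP => v; rewrite !inE => /andP[/andP[_ ->]].
  by have [->|//] := eqVneq v h; rewrite eq_sym (negPf bN).
have acg : acyclic (color_class (A :\ h) f b :\ g).
  by apply: acyclicS (acf b); apply: subsetDl.
apply: (@acyclicS _ (h |: (color_class (A :\ h) f b :\ g))).
  by apply/subsetP => v; rewrite !inE; case: (v == h); case: (v == g).
have inB u : u \in color_class (A :\ h) f b :\ g -> [/\ u \in A, f u = f g & u != g].
  by rewrite !inE => /andP[-> /andP[/andP[_ ->] /eqP ->]]; rewrite bE fgh.
case/orP: adj => [gh|hg].
  apply: acyclic_add_source => // u /inB[uA fu /eqP ug]; apply/negP => uh.
  by apply: ug; apply: (hole_in_neighbor_uniq cfh).
apply: acyclic_add_sink => // u /inB[uA fu /eqP ug]; apply/negP => uh.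
by apply: ug; apply: (hole_out_neighbor_uniq cfh).
Qed.

(** [s] lists the past holes, latest first; moves go to in-neighbours, so the arcs run from [h]
    along [s]. The last clause prevents a return: the next hole has an in-neighbour of its own
    colour, which no vertex of [s] has, apart possibly from [h]. *)
Definition hole_trail f h s := [/\ colored_off f h,
  path [rel x y | arc x y && (f x != f y)] h s, uniq (h :: s), {subset s <= A} &
  forall v u, v \in s -> u \in A -> u != h -> arc u v -> f u != f v].

(* Move the hole to its in-neighbour [g] of the colour opposite to the last
   one used. If the out-neighbour [o] of the hole of that colour is on the
   trail, moving the hole to [o] instead gives a contradiction: the
   predecessor of [o] on the trail is its only in-neighbour of the other
   colour, but has itself no in-neighbour of that colour. *)
Lemma hole_trailS f h s : hole_trail f h s ->
  exists f' h', hole_trail f' h' (h :: s).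
Proof.
move=> [cfh ps us sA src].
have [g [o [x [gb ob xb [gh ho xg]]]]] := hole_neighbors (f h) cfh.
move: gb ob xb; rewrite !inE -!andbA.
move=> /and3P[gh' gA /eqP fg] /and3P[oh oA /eqP fo] /and3P[xh xA /eqP fx].
have gNs : g \notin s.
  by apply/negP => gs; have := src _ _ gs xA xh xg; rewrite fx fg eqxx.
have oNs : o \notin s.
  apply/negP => os; case/splitPr: os ps src sA {us gNs} => s1 s2.
  rewrite cat_path /= => /andP[_ /andP[/andP[po fpo] _]] src sA.
  have cfo : colored_off f o by apply: (colored_off_move cfh oA fo); rewrite /adjacent /= ho orbT.
  have [q [_ [y [qb _ yb [qo _ yq]]]]] := hole_neighbors (~~ f h) cfo.
  move: qb yb; rewrite !inE -!andbA => /and3P[_ qA /eqP fq] /and3P[_ yA /eqP fy].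
  have ps : last h s1 \in s1 ++ o :: s2.
    have := mem_last h s1; rewrite in_cons => /orP[/eqP ph|]; last by rewrite mem_cat => ->.
    by rewrite ph fo eqxx in fpo.
  have fp : f (last h s1) = ~~ f h.
    by move: fpo; rewrite fo; case: (f _); case: (f h).
  have qp : q = last h s1.
    by apply: (hole_in_neighbor_uniq cfo) => //; [exact: sA|rewrite fq fp].
  have yh : y != h by apply: contraPneq fy => ->; case: (f h).
  by have := src _ _ ps yA yh; rewrite -qp yq fy fq eqxx => /(_ isT).
have [f' f'g f'E] : exists2 f', f' g = ~~ f h & forall v, v != g -> f' v = f v.
  by exists [eta f with g |-> ~~ f h] => [|v /negPf vg]; rewrite /= ?eqxx ?vg.
have hg : h != g by rewrite eq_sym.
have neq v : v \in s -> v != g by apply: contraTneq => ->.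
have cfg : colored_off f g.
  by apply: (colored_off_move cfh gA fg); rewrite /adjacent /= gh.
exists f', g; split.
- by apply: colored_off_eq cfg => v vg; rewrite f'E.
- rewrite /= gh f'g (f'E h) //=; apply/andP; split; first by case: (f h).
  rewrite (eq_in_path (P := mem (h :: s)) (e' := [rel x y | arc x y && (f x != f y)])) //.
    move=> u v; rewrite !inE => us' vs' /=; rewrite !f'E //.
      by case/orP: vs' => [/eqP->|/neq].
    by case/orP: us' => [/eqP->|/neq].
  by apply/allP => v.
- by rewrite cons_uniq us andbT inE negb_or eq_sym hg.
- by move=> v; rewrite inE => /orP[/eqP->|/sA //]; case: cfh.
(* For [v = h], the only in-neighbour of its colour is [g], the new hole. For an older [v], the old
   invariant leaves only [u = h], now coloured; then [v] would be the out-neighbour [o], which is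
   off the trail. *)
- move=> v u vs uA ug uv.
  have vg : v != g by move: vs; rewrite inE => /orP[/eqP->|/neq].
  rewrite !f'E //; apply/eqP => fuv.
  move: vs; rewrite inE => /orP[/eqP vh|vs].
    rewrite {}vh {vg} in uv fuv; move/eqP: ug; apply.
    by apply: (hole_in_neighbor_uniq cfh) => //; rewrite fg.
  have [uh|uh] := eqVneq u h; last by have := src _ _ vs uA uh uv; rewrite fuv eqxx.
  rewrite {}uh {ug uA} in uv fuv; move: oNs.
  suff -> : o = v by rewrite vs.
  by apply: (hole_out_neighbor_uniq cfh) => //; [exact: sA|rewrite fo].
Qed.

(** Trails never repeat a vertex, yet could be prolonged beyond the number of vertices. *)
Lemma not_colored_off f h : ~ colored_off f h.
Proof.
move=> cfh.
have [f' [h' [s [[_ _ us _ _] ss]]]] :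
    exists f' h' s, hole_trail f' h' s /\ size s = #|D|.
  elim: #|D| => [|n [f' [h' [s [tr ss]]]]]; first by exists f, h, [::]; split.
  have [f2 [h2 tr2]] := hole_trailS tr.
  by exists f2, h2, (h' :: s); rewrite /= ss.
have := max_card (mem (h' :: s)); rewrite (card_uniqP us) /= ss.
by rewrite ltnn.
Qed.

End FourDegrees.

Lemma degree4_bicolorable A : digon_free D ->
  (forall v, v \in A -> degree A v <= 4) ->
  exists f : D -> bool, forall b, acyclic (color_class A f b).
Proof.
move=> nod; have [n] := ubnP #|A|; elim: n => // n IH in A * => /ltnSE cA degA.
have [->|[h hA]] := set_0Vmem A.
  exists xpredT => b; apply: acyclicS acyclic0.
  by apply/subsetP => v; rewrite !inE.
have [||f acf] := IH (A :\ h).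
- by move: cA; rewrite (cardsD1 h) hA.
- move=> v; rewrite inE => /andP[_ vA]; apply: leq_trans (degA v vA).
  apply: leq_add; apply: subset_leq_card; apply/subsetP => u;
    by rewrite !inE => /andP[/andP[_ ->]].
apply: contrapT => nbi; exact: (not_colored_off nod degA nbi (conj hA acf)).
Qed.

(** * Colouring from a bound on the total degree *)

Lemma degree_colorable4 : digon_free D -> degree_colorable 4 2.
Proof.
move=> nod A degA; have [f acf] := degree4_bicolorable nod degA.
exists (fun v => f v : nat); split=> [v _|i]; first by case: (f v).
apply: acyclicS (acf (i == 1)); apply/subsetP => v; rewrite !inE => /andP[-> /eqP <-].
by case: (f v).
Qed.

(** This joins [n + 1] parts of degree at most 4 and [s] parts of degree at most 1; each join gains
    one extra unit of degree. *)
Lemma degree_colorable_linear n s : digon_free D ->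
  degree_colorable (5 * n + 4 + 2 * s) (2 * n + 2 + s).
Proof.
move=> nod; elim: s => [|s IHs].
  elim: n => [|n IHn]; first exact: degree_colorable4.
  have := degree_colorableD IHn (degree_colorable4 nod).
  by congr degree_colorable; lia.
have := degree_colorableD IHs degree_colorable1.
by congr degree_colorable; lia.
Qed.

(** * Critical sets and the bound on the dichromatic number *)

Lemma fresh_color k (f : D -> nat) B : #|B| < k -> exists2 i, i < k & forall u, u \in B -> f u != i.
Proof.
move=> Bk; apply: contrapT => nex; move: Bk; rewrite ltnNge => /negP; apply.
rewrite cardE -(size_map f) -[leqLHS](size_iota 0); apply: uniq_leq_size; first exact: iota_uniq.
move=> i; rewrite mem_iota add0n /= => ik; apply: contrapT => /negP iN.
apply: nex; exists i => // u uB; apply: contraNneq iN => <-.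
by apply: map_f; rewrite mem_enum.
Qed.

(** A colour missing among the in-neighbours (or out-neighbours) of [h] makes [h] a source (or sink)
    of that class. *)
Lemma colorable_add k h A : h \in A -> colorable (A :\ h) k ->
  (in_degree A h < k \/ out_degree A h < k) -> colorable A k.
Proof.
move=> hA [f [fk acf]] deg.
have [i ik ach] : exists2 i, i < k & acyclic (h |: color_class (A :\ h) f i).
  case: deg => /(@fresh_color _ f)[i ik fi]; exists i => //.
    apply: acyclic_add_source => // u; rewrite !inE => /andP[/andP[_ uA] /eqP fu].
    by apply: contraPN fu => uh; apply/eqP/fi; rewrite inE uA.
  apply: acyclic_add_sink => // u; rewrite !inE => /andP[/andP[_ uA] /eqP fu].
  by apply: contraPN fu => uh; apply/eqP/fi; rewrite inE uA.
exists [eta f with h |-> i]; split=> [v vA /=|j].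
  by case: eqP => // /eqP vh; apply: fk; rewrite !inE vh.
have [->|ji] := eqVneq j i.
  apply: acyclicS ach; apply/subsetP => v; rewrite !inE /=.
  by case: (v == h).
apply: acyclicS (acf j); apply/subsetP => v; rewrite !inE /=.
by have [_|//] := eqVneq v h; rewrite [_ == j]eq_sym (negPf ji) andbF.
Qed.

Lemma critical_subset k A : ~ colorable A k ->
  exists2 B, ~ colorable B k &
    forall v, v \in B -> k <= in_degree B v /\ k <= out_degree B v.
Proof.
have [n] := ubnP #|A|; elim: n => // n IH in A * => /ltnSE cA ncA.
have [[v vA cAv]|nex] := pselect (exists2 v, v \in A & ~ colorable (A :\ v) k).
  by apply: IH cAv; move: cA; rewrite (cardsD1 v) vA.
exists A => // v vA.
have cAv : colorable (A :\ v) k by apply: contrapT => ncAv; apply: nex; exists v.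
by split; rewrite leqNgt; apply/negP => lt; apply: ncA;
  apply: (colorable_add vA cAv); [left|right].
Qed.

Lemma colorable_geom_degree N k : digon_free D ->
  (forall v : D, outdeg v * indeg v <= N) -> 2 <= k -> 2 * N + k < 3 * k ^ 2 ->
  colorable [set: D] k.
Proof.
move=> nod degN k2 kN; apply: contrapT => /critical_subset[B ncB degB]; apply: ncB.
have kE : k = 2 * (k./2.-1) + 2 + odd k by have := odd_double_half k; lia.
rewrite kE; apply: degree_colorable_linear => // v vB.
have [kin kout] := degB v vB.
have xyN : out_degree B v * in_degree B v <= N.
  by apply: leq_trans (degN v); apply: leq_mul; [exact: out_degree_le|exact: in_degree_le].
rewrite /degree; move: (out_degree B v) (in_degree B v) kin kout xyN => x y ky kx xyN.
(* From [(x - k) * (y - k) >= 0] follows [k * (x + y) <= N + k ^ 2]; doubling gives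
   [2 * k * (x + y) < 5 * k ^ 2 - k]. *)
have : 2 * (x + y) + 1 < 5 * k by nia.
by have := odd_double_half k; lia.
Qed.

Lemma dichromatic_number_le k : colorable [set: D] k -> dichromatic_number D <= k.
Proof.
move=> [f [fk acf]].
pose P := preim_partition f [set: D].
have cP : #|P| <= k.
  (* Only colours actually used give blocks, so there may be fewer than [k] of them. *)
  have -> : P = (fun i : 'I_k => [set y | val i == f y]) @: [set i | [exists x, f x == val i]].
    apply/setP => B; apply/imsetP/imsetP => [[x _ ->]|[i]].
      exists (Ordinal (fk x (in_setT x))); last by apply/setP => y; rewrite !inE.
      by rewrite inE; apply/existsP; exists x.
    rewrite inE => /existsP[x /eqP xi] ->; exists x => //.
    by apply/setP => y; rewrite !inE xi.
  apply: leq_trans (leq_imset_card _ _) _.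
  by rewrite -[leqRHS]card_ord max_card.
apply: leq_trans cP; rewrite /dichromatic_number.
case: ex_minnP => m _; apply; apply/asboolP; exists P; split=> //; split.
  exact: preim_partitionP.
move=> B /imsetP[x _ ->]; apply: acyclicS (acf (f x)).
by apply/subsetP => y; rewrite !inE eq_sym.
Qed.

End Coloring.

(** * Passage to real numbers and the constant *)

Lemma max_geom_degree_attained (R : realType) (D : digraph) : 0 < max_geom_degree D R ->
  exists v : D, max_geom_degree D R = Num.sqrt ((outdeg v)%:R * (indeg v)%:R).
Proof.
move=> M0; suff [M_0|//] : max_geom_degree D R = 0 \/
    exists v : D, max_geom_degree D R = Num.sqrt ((outdeg v)%:R * (indeg v)%:R).
  by rewrite M_0 ltxx in M0.
rewrite /max_geom_degree; elim/big_ind: _ => [|x y|v _]; [by left| |by right; exists v].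
by rewrite /Num.max; case: ifP.
Qed.

Theorem theorem7 (R : realType) :
  exists alpha : R, alpha < 1 /\
    forall D : digraph,
      connected_digraph D -> digon_free D -> 1 < max_geom_degree D R ->
      (dichromatic_number D)%:R <= alpha * (max_geom_degree D R + 1).
Proof.
(* The tightest case is [k = 3], where [M ^+ 2 >= 5] and 3 / (sqrt 5 + 1) < 0.93. *)
exists (19%:R / 20%:R); split; first by lra.
move=> D _ nod M1.
have [v0 Mv0] := max_geom_degree_attained (lt_trans ltr01 M1).
set M := max_geom_degree D R in M1 Mv0 *.
pose N := (outdeg v0 * indeg v0)%N.
have MN : M ^+ 2 = N%:R by rewrite Mv0 sqr_sqrtr -natrM ?ler0n.
have degN (v : D) : (outdeg v * indeg v <= N)%N.
  rewrite -(ler_nat R) natrM -MN -[leLHS]sqr_sqrtr -?natrM ?ler0n //.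
  rewrite ler_sqr ?nnegrE ?sqrtr_ge0 ?(le_trans ler01 (ltW M1)) // natrM.
  exact: (le_bigmax 0 (fun v : D => Num.sqrt ((outdeg v)%:R * (indeg v)%:R) : R) v).
(* Integrality matters: [M > 1] alone gives only the bound 19/10, short of 2 when [k = 2]. *)
have N2 : (2 <= N)%N by rewrite -(ltr_nat R) -MN; nra.
have exk : exists k, (2 <= k)%N && (2 * N + k < 3 * k ^ 2)%N.
  by exists N.+2; nia.
have [k /andP[k2 kN] kmin] := ex_minnP exk.
have chik : (dichromatic_number D <= k)%N.
  apply: dichromatic_number_le; exact: colorable_geom_degree nod degN k2 kN.
apply: le_trans (_ : k%:R <= _); first by rewrite ler_nat.
have [->|k3] : k = 2%N \/ (3 <= k)%N by lia.
  have : 2%:R <= M ^+ 2 by rewrite MN ler_nat.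
  by nra.
(* As [k.-1] is still at least 2, minimality of [k] means that it fails the second condition. *)
have kN' : (3 * k.-1 ^ 2 <= 2 * N + k.-1)%N.
  rewrite leqNgt; apply/negP => lt; have := kmin k.-1; rewrite lt andbT.
  by move=> /(_ ltac:(lia)); lia.
have kE : k%:R = k.-1%:R + 1 :> R by rewrite natr1 prednK //; lia.
have : 3%:R * k.-1%:R ^+ 2 <= 2%:R * M ^+ 2 + k.-1%:R.
  by rewrite MN -natrX -!natrM -natrD ler_nat.
have : 2%:R <= k.-1%:R :> R by rewrite ler_nat; lia.
rewrite kE; move: (k.-1%:R : R) => K K2 KM.
rewrite leNgt; apply/negP => lt.
have MK : M < 20%:R / 19%:R * (K + 1) - 1 by lra.
have : M ^+ 2 < (20%:R / 19%:R * (K + 1) - 1) ^+ 2.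
  by rewrite ltr_pXn2r // nnegrE; lra.
(* Inserting the bound on [M ^+ 2] into [KM] gives [3 * K ^+ 2 - K < 2 * (20 * K + 1) ^+ 2 / 361],
   false for [K >= 2]. *)
by nra.
Qed.
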